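(* Let $E\in\mathbb R^{k\times N}$ be a nonzero matrix, $A\in\mathbb R^{m\times N}$, $y\in\mathbb R^m$, $C\in\mathbb R^{p\times N}$, $d\in\mathbb R^p$, $\varepsilon\in\mathbb R$, and let $f:\mathbb R^m\to\mathbb R$ be a $C^1$ strictly convex function. Suppose the problem $$(\mathrm{D1}):\quad\min_{x\in\mathbb R^N}\|Ex\|_1\quad\text{subject to}\quad f(Ax-y)\le\varepsilon,\ \ Cx\ge d$$ has an optimal solution, let $x^*\in\mathbb R^N$ be a feasible point of (D1), and let $\alpha$, $\mathcal S$, $b$ be as defined in the context. C.1. Suppose $f(Ax^*-y)<\varepsilon$. Then $x^*$ is the unique minimizer of (D1) if and only if $\begin{bmatrix} C_{\alpha\bullet} \\ E_{\mathcal S^c\bullet} \end{bmatrix}$ has full column rank and there exist $u\in\mathbb R^{|\alpha|}_{++}$ and $u'\in\mathbb R^{|\mathcal S^c|}$ with $\|u'\|_\infty<1$ such that $C_{\alpha\bullet}^Tu=b+E_{\mathcal S^c\bullet}^Tu'$. C.2. Suppose $f(Ax^*-y)=\varepsilon$. Then $x^*$ is the unique minimizer of (D1) if and only if the following conditions hold: (a) the matrix $\begin{bmatrix} A \\ C_{\alpha\bullet} \\ E_{\mathcal S^c\bullet} \end{bmatrix}$ has full column rank; (b) there exist $u\in\mathbb R^m$, $u'\in\mathbb R^{|\alpha|}_{++}$, and $u''\in\mathbb R^{|\mathcal S^c|}$ with $\|u''\|_\infty<1$ such that $A^Tu+C_{\alpha\bullet}^Tu'-E_{\mathcal S^c\bullet}^Tu''=b$;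 (c) if $\mathcal K:=\{v\in\mathbb R^N\mid(\nabla f(Ax^*-y))^TAv<0,\ C_{\alpha\bullet}v\ge0\}$ is nonempty, then there exist a positive real number $\theta$, $\widetilde u\in\mathbb R^{|\alpha|}_+$, and $\widetilde u'\in\mathbb R^{|\mathcal S^c|}$ with $\|\widetilde u'\|_\infty\le1$ such that $\theta\cdot A^T\nabla f(Ax^*-y)-C_{\alpha\bullet}^T\widetilde u+b+E_{\mathcal S^c\bullet}^T\widetilde u'=0$.
   Context: Vector inequalities are componentwise; $\mathbb R^n_+$ and $\mathbb R^n_{++}$ are the nonnegative and (strictly) positive orthants. For a matrix $M$ and row index set $\beta$, $M_{\beta\bullet}$ is the submatrix of rows indexed by $\beta$. Given $x^*$: $\alpha:=\{i\in\{1,\ldots,p\}\mid(Cx^*-d)_i=0\}$; $\mathcal S:=\{i\in\{1,\ldots,k\}\mid(Ex^* )_i\ne0\}$ with complement $\mathcal S^c$ in $\{1,\ldots,k\}$; $\widehat b:=\mathrm{sgn}((Ex^* )_{\mathcal S})\in\{\pm1\}^{|\mathcal S|}$ (componentwise sign) and $b:=E_{\mathcal S\bullet}^T\widehat b\in\mathbb R^N$ (so $b=0$ if $\mathcal S=\emptyset$). *)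

(* Defs.v *)
From HB Require Import structures.
From mathcomp Require Export all_boot all_order all_algebra.
From mathcomp Require Export all_classical all_reals all_analysis.
Export Order.TTheory GRing.Theory Num.Theory.
Export numFieldNormedType.Exports.

Set Implicit Arguments.
Unset Strict Implicit.
Unset Printing Implicit Defensive.

Local Open Scope classical_set_scope.
Local Open Scope ring_scope.

Section Vectors.
Context {R : realType}.

Definition vec_ge (n : nat) (v w : 'cV[R]_n) : Prop :=
  forall i, w i ord0 <= v i ord0.

Definition vec_gt (n : nat) (v w : 'cV[R]_n) : Prop :=
  forall i, w i ord0 < v i ord0.

(* The l^infinity norm is the library norm `|v|, which on matrices is the
   maximum of the absolute values of the entries (0 on an empty matrix). *)
Definition norm1 (n : nat) (v : 'cV[R]_n) : R := \sum_i `|v i ord0|.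

(* M_{beta,.}, with the rows listed in increasing order of their index. *)
Definition subrows (q n : nat) (M : 'M[R]_(q, n)) (beta : {set 'I_q}) :
  'M[R]_(#|beta|, n) := rowsub (@enum_val _ (mem beta)) M.

Definition full_column_rank (q n : nat) (M : 'M[R]_(q, n)) : Prop :=
  \rank M = n.

End Vectors.

Section Functions.
Context {R : realType} (m : nat).
Implicit Type f : 'cV[R]_m -> R.

Definition strictly_convex f : Prop :=
  forall (x y : 'cV[R]_m) (t : R), x != y -> 0 < t < 1 ->
    f (t *: x + (1 - t) *: y) < t * f x + (1 - t) * f y.

Definition grad f (z : 'cV[R]_m) : 'cV[R]_m :=
  \col_i 'D_(delta_mx i ord0) f z.

Definition C1_function f : Prop :=
  (forall z, differentiable f z) /\ continuous (grad f).

End Functions.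

Section Minimizers.
Context {R : realType} (T : Type) (F : T -> R) (feas : set T).

Definition is_minimizer (x : T) : Prop :=
  feas x /\ forall z, feas z -> F x <= F z.

Definition is_unique_minimizer (x : T) : Prop :=
  is_minimizer x /\ forall z, is_minimizer z -> z = x.

End Minimizers.

Section ProblemData.
Context {R : realType} (N : nat).

Definition feasible_set (m p : nat) (f : 'cV[R]_m -> R) (A : 'M[R]_(m, N))
    (y : 'cV[R]_m) (eps : R) (C : 'M[R]_(p, N)) (d : 'cV[R]_p) :
    set 'cV[R]_N :=
  [set x | f (A *m x - y) <= eps /\ vec_ge (C *m x) d].

Definition active_set (p : nat) (C : 'M[R]_(p, N)) (d : 'cV[R]_p)
    (x : 'cV[R]_N) : {set 'I_p} :=
  [set i | (C *m x - d) i ord0 == 0]%SET.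

Definition support_set (k : nat) (E : 'M[R]_(k, N)) (x : 'cV[R]_N) :
    {set 'I_k} :=
  [set i | (E *m x) i ord0 != 0]%SET.

Definition sign_vec (k : nat) (E : 'M[R]_(k, N)) (x : 'cV[R]_N) :
    'cV[R]_#|support_set E x| :=
  map_mx Num.sg (subrows (E *m x) (support_set E x)).

Definition b_vec (k : nat) (E : 'M[R]_(k, N)) (x : 'cV[R]_N) : 'cV[R]_N :=
  (subrows E (support_set E x))^T *m sign_vec E x.

End ProblemData.

(* Main.v *)
(* For small steps [x |-> norm1 (E *m x)] is affine along every direction [v],
   with slope phi(v) = b.v + |E_{S^c} v|_1, and by strict convexity of [f] a
   direction is feasible iff C_alpha v >= 0 and, when the convex constraint is
   active, A v = 0 or grad f . A v < 0. So [xs] is the unique minimizer iff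
   phi > 0 on the nonzero feasible directions. On the directions with A v = 0 the
   dual form of this, with strict multipliers, is full rank together with (b); on
   those with grad f . A v < 0 it is (c). Both follow from Farkas' lemma after
   |E_{S^c} v| is bounded by an auxiliary variable [w]. *)
Require Import Defs.
From mathcomp Require Import lra.

Set Implicit Arguments.
Unset Strict Implicit.
Unset Printing Implicit Defensive.

Local Open Scope classical_set_scope.
Local Open Scope ring_scope.

(** * Scalar products, the two norms and column rank *)

Definition dot {R : realType} {n} (u v : 'cV[R]_n) : R := (u^T *m v) ord0 ord0.

Section Dot.
Context {R : realType}.
Implicit Types n q : nat.

Lemma dotE n (u v : 'cV[R]_n) : dot u v = \sum_i u i ord0 * v i ord0.
Proof. by rewrite /dot mxE; apply: eq_bigr => i _; rewrite mxE. Qed.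

Lemma dotDl n (u v w : 'cV[R]_n) : dot (u + v) w = dot u w + dot v w.
Proof. by rewrite /dot linearD mulmxDl mxE. Qed.

Lemma dotDr n (u v w : 'cV[R]_n) : dot u (v + w) = dot u v + dot u w.
Proof. by rewrite /dot mulmxDr mxE. Qed.

Lemma dotNl n (u v : 'cV[R]_n) : dot (- u) v = - dot u v.
Proof. by rewrite /dot linearN mulNmx mxE. Qed.

Lemma dotNr n (u v : 'cV[R]_n) : dot u (- v) = - dot u v.
Proof. by rewrite /dot mulmxN mxE. Qed.

Lemma dotZl n a (u v : 'cV[R]_n) : dot (a *: u) v = a * dot u v.
Proof. by rewrite /dot linearZ -scalemxAl mxE. Qed.

Lemma dotZr n a (u v : 'cV[R]_n) : dot u (a *: v) = a * dot u v.
Proof. by rewrite /dot -scalemxAr mxE. Qed.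

Lemma dot0r n (u : 'cV[R]_n) : dot u 0 = 0.
Proof. by rewrite /dot mulmx0 mxE. Qed.

Lemma dotC n (u v : 'cV[R]_n) : dot u v = dot v u.
Proof. by rewrite !dotE; apply: eq_bigr => i _; rewrite mulrC. Qed.

Lemma dot_trmul n q (M : 'M[R]_(q, n)) (u : 'cV[R]_q) (v : 'cV[R]_n) :
  dot (M^T *m u) v = dot u (M *m v).
Proof. by rewrite /dot trmx_mul trmxK mulmxA. Qed.

Lemma dot_col_mx n q (u u' : 'cV[R]_n) (v v' : 'cV[R]_q) :
  dot (col_mx u v) (col_mx u' v') = dot u u' + dot v v'.
Proof. by rewrite /dot tr_col_mx mul_row_col mxE. Qed.

Lemma dot_ge0 n (u v : 'cV[R]_n) : vec_ge u 0 -> vec_ge v 0 -> 0 <= dot u v.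
Proof.
move=> u0 v0; rewrite dotE sumr_ge0 // => i _.
by have := u0 i; have := v0 i; rewrite mxE => ? ?; rewrite mulr_ge0.
Qed.

(** All terms [u i * v i] are nonnegative and their sum is at most 0, so each vanishes; [u i > 0]
    then leaves [v i = 0]. *)
Lemma dot_gt_eq0 n (u v : 'cV[R]_n) :
  vec_gt u 0 -> vec_ge v 0 -> dot u v <= 0 -> v = 0.
Proof.
move=> u0 v0; rewrite dotE => uv.
have uv0 i : 0 <= u i ord0 * v i ord0.
  by have := u0 i; have := v0 i; rewrite mxE => ? /ltW ?; rewrite mulr_ge0.
have {}uv : \sum_i u i ord0 * v i ord0 = 0.
  by apply/eqP; rewrite eq_le uv sumr_ge0.
apply/matrixP => i j; rewrite (ord1 j).
have /(_ i isT)/eqP := psumr_eq0P (fun i _ => uv0 i) uv.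
have := u0 i; rewrite !mxE mulf_eq0 => /gt_eqF ->.
by move/eqP.
Qed.

Lemma dot1_norm1 n (v : 'cV[R]_n) : vec_ge v 0 -> dot (const_mx 1) v = norm1 v.
Proof.
move=> v0; rewrite dotE; apply: eq_bigr => i _.
by have := v0 i; rewrite !mxE mul1r => ?; rewrite ger0_norm.
Qed.

Lemma vec_ge_col_mx n q (u : 'cV[R]_n) (v : 'cV[R]_q) :
  vec_ge (col_mx u v) 0 <-> vec_ge u 0 /\ vec_ge v 0.
Proof.
split=> [uv|[u0 v0] i].
  split=> i; first by have := uv (lshift q i); rewrite col_mxEu !mxE.
  by have := uv (rshift n i); rewrite col_mxEd !mxE.
by rewrite !mxE; case: splitP => j _; [have := u0 j | have := v0 j];
  rewrite mxE.
Qed.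

Lemma vec_gt_col_mx n q (u : 'cV[R]_n) (v : 'cV[R]_q) :
  vec_gt (col_mx u v) 0 -> vec_gt u 0 /\ vec_gt v 0.
Proof.
move=> uv; split=> i.
  by have := uv (lshift q i); rewrite col_mxEu !mxE.
by have := uv (rshift n i); rewrite col_mxEd !mxE.
Qed.

(** The condition on [r] accounts for the empty vector, whose norm is 0; likewise in the strict
    version. *)
Lemma mx_norm_leP n (v : 'cV[R]_n) (r : R) : 0 <= r ->
  `|v| <= r <-> forall i, `|v i ord0| <= r.
Proof.
move=> r0; rewrite [`|v|]/Num.norm /= mx_normrE; split=> [/bigmax_leP[_ h] i|h].
  exact: (h (i, ord0)).
by apply/bigmax_leP; split=> // -[i j] _ /=; rewrite (ord1 j).
Qed.

Lemma mx_norm_ltP n (v : 'cV[R]_n) (r : R) : 0 < r ->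
  `|v| < r <-> forall i, `|v i ord0| < r.
Proof.
move=> r0; rewrite [`|v|]/Num.norm /= mx_normrE; split=> [/bigmax_ltP[_ h] i|h].
  exact: (h (i, ord0)).
by apply/bigmax_ltP; split=> // -[i j] _ /=; rewrite (ord1 j).
Qed.

Lemma dot_le_norm1 n (u v : 'cV[R]_n) : `|u| <= 1 -> dot u v <= norm1 v.
Proof.
move=> /(mx_norm_leP _ ler01) u1; rewrite dotE ler_sum // => i _.
by rewrite (le_trans (ler_norm _)) // normrM ler_piMl.
Qed.

(** Equality case of Hoelder's inequality: every gap [|v i| - u i * v i] is nonnegative, hence zero,
    which [|u i| < 1] allows only for [v i = 0]. *)
Lemma dot_ge_norm1_eq0 n (u v : 'cV[R]_n) :
  `|u| < 1 -> norm1 v <= dot u v -> v = 0.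
Proof.
move=> /(mx_norm_ltP _ ltr01) u1; rewrite dotE -subr_le0 -sumrB => uv.
have uv0 i : 0 <= `|v i ord0| - u i ord0 * v i ord0.
  rewrite subr_ge0 (le_trans (ler_norm _)) // normrM ler_piMl //.
  exact/ltW.
have {}uv : \sum_i (`|v i ord0| - u i ord0 * v i ord0) = 0.
  by apply/eqP; rewrite eq_le uv sumr_ge0.
apply/matrixP => i j; rewrite (ord1 j) mxE.
have /(_ i isT)/eqP := psumr_eq0P (fun i _ => uv0 i) uv.
rewrite subr_eq0 => /eqP e; apply/eqP; rewrite -normr_le0 leNgt.
apply/negP => vi0.
suff : `|v i ord0| < `|v i ord0| by rewrite ltxx.
rewrite {1}e (le_lt_trans (ler_norm _)) // normrM.
by rewrite gtr_pMl.
Qed.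

Lemma norm10 n : norm1 (0 : 'cV[R]_n) = 0.
Proof. by rewrite /norm1 big1 // => i _; rewrite mxE normr0. Qed.

Lemma full_column_rankP q n (M : 'M[R]_(q, n)) :
  full_column_rank M <-> forall v : 'cV[R]_n, M *m v = 0 -> v = 0.
Proof.
rewrite /full_column_rank; split=> [rM v Mv|kM].
  have fM : row_free M^T by rewrite /row_free mxrank_tr rM.
  apply: trmx_inj; apply: (row_free_inj fM).
  by rewrite /= trmx0 mul0mx -trmx_mul Mv trmx0.
apply/eqP; rewrite -mxrank_tr; apply: inj_row_free => v vM.
apply: trmx_inj; rewrite trmx0; apply: kM.
by rewrite -[M]trmxK -trmx_mul vM trmx0.
Qed.

Lemma full_column_rank_col_mx q r n (M : 'M[R]_(q, n)) (M' : 'M[R]_(r, n)) :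
  full_column_rank (col_mx M M') <->
  forall v : 'cV[R]_n, M *m v = 0 -> M' *m v = 0 -> v = 0.
Proof.
split=> [/full_column_rankP h v Mv M'v|h].
  by apply: h; rewrite mul_col_mx Mv M'v col_mx0.
apply/full_column_rankP => v; rewrite mul_col_mx -col_mx0.
by move=> /eq_col_mx[]; exact: h.
Qed.

End Dot.

(** * Farkas' lemma and a variant with positive multipliers *)

Section Farkas.
Context {R : realType}.

(* Induction on the number of rows: if the last inequality is needed, project
   along a vector [x] that violates it alone. *)
Lemma farkas q n (M : 'M[R]_(q, n)) (c : 'cV[R]_n) :
  (forall v, vec_ge (M *m v) 0 -> 0 <= dot c v) ->
  exists2 u : 'cV[R]_q, vec_ge u 0 & c = M^T *m u.
Proof.
elim: q M c => [|q IH] M c Mc.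
  exists 0; first by move=> i; rewrite mxE.
  have h v : dot c v = 0.
    apply/eqP; rewrite eq_le -oppr_ge0 -dotNr.
    by rewrite !Mc // => -[].
  rewrite mulmx0; apply/matrixP => i j; rewrite (ord1 j) mxE.
  rewrite -(h (delta_mx i ord0)) dotE (bigD1 i) //= big1 => [|l li].
    by rewrite mxE !eqxx mulr1 addr0.
  by rewrite mxE (negPf li) mulr0.
move: M Mc; rewrite -[q.+1]/(1 + q)%N => M Mc.
pose a : 'cV[R]_n := (usubmx M)^T; pose M' := dsubmx M.
have ME : M = col_mx a^T M' by rewrite trmxK vsubmxK.
have Mv_ge0 v : 0 <= dot a v -> vec_ge (M' *m v) 0 -> vec_ge (M *m v) 0.
  move=> av M'v; rewrite ME mul_col_mx.
  apply/vec_ge_col_mx; split=> // i.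
  by rewrite (ord1 i) mxE.
have [h|/existsNP[x /not_implyP[M'x /negP]]] :=
  pselect (forall v, vec_ge (M' *m v) 0 -> 0 <= dot c v).
  have [u u0 ->] := IH _ _ h.
  exists (col_mx 0 u).
    by apply/vec_ge_col_mx; split=> // i; rewrite mxE.
  by rewrite ME tr_col_mx mul_row_col mulmx0 add0r.
rewrite -ltNge => cx.
have ax : dot a x < 0.
  rewrite ltNge; apply/negP => ax.
  suff : 0 <= dot c x by rewrite leNgt cx.
  exact/Mc/Mv_ge0.
(* Scaled so that [dot a y = -1]: then [v + dot a v *: y] lies in the hyperplane orthogonal to [a]
   for every [v]. *)
pose y := (- dot a x)^-1 *: x.
have ay : dot a y = -1.
  by rewrite /y dotZr invrN mulNr mulVf // lt_eqF.
have cy : dot c y < 0.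
  by rewrite dotZr pmulr_rlt0 // invr_gt0 oppr_gt0.
have M'y : vec_ge (M' *m y) 0.
  move=> i; rewrite -scalemxAr !mxE; have := M'x i; rewrite !mxE => ?.
  by rewrite mulr_ge0 // invr_ge0 oppr_ge0 ltW.
(* [M2] and [c2] are [M'] and [c] composed with this projection, so the row [a] holds for free and
   the induction hypothesis applies. *)
pose M2 := M' + (M' *m y) *m a^T.
pose c2 := c + dot c y *: a.
have aE v : a^T *m v = (dot a v)%:M.
  by rewrite [LHS]mx11_scalar.
have M2E v : M2 *m v = M' *m (v + dot a v *: y).
  by rewrite mulmxDl mulmxDr -mulmxA aE mul_mx_scalar scalemxAr.
have c2E v : dot c2 v = dot c (v + dot a v *: y).
  by rewrite dotDl dotDr dotZl [in RHS]dotZr mulrC.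
have [v M2v|u u0 c2u] := IH M2 c2.
  rewrite c2E; apply/Mc/Mv_ge0; last by rewrite -M2E.
  by rewrite dotDr [X in _ + X]dotZr ay mulrN1 subrr.
(* The multiplier of [a] comes from solving [c2 = M2^T *m u] for [c]; it is nonnegative because
   [M' *m y >= 0] and [dot c y < 0]. *)
exists (col_mx (dot u (M' *m y) - dot c y)%:M u).
  apply/vec_ge_col_mx; split=> // i.
  by rewrite (ord1 i) !mxE eqxx mulr1n subr_ge0 (le_trans (ltW cy)) // dot_ge0.
rewrite ME tr_col_mx mul_row_col trmxK.
rewrite mul_mx_scalar scalerBl.
apply: (addIr (dot c y *: a)); rewrite -/c2 c2u /M2 linearD /= trmx_mul trmxK.
rewrite mulmxDl -mulmxA [(M' *m y)^T *m u]mx11_scalar mul_mx_scalar.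
by rewrite -/(dot (M' *m y) u) dotC addrAC subrK addrC.
Qed.

(* If [M v >= 0] and [c v <= 0] only when [M v = 0], then [-1^T M] is a
   nonnegative combination [l^T M - t c]; adding [c = w^T M] gives
   [(1 + t) c = (1 + l + w)^T M]. *)
Lemma strict_farkas q n (M : 'M[R]_(q, n)) (c : 'cV[R]_n) :
  (forall v, vec_ge (M *m v) 0 -> 0 <= dot c v) ->
  (forall v, vec_ge (M *m v) 0 -> dot c v <= 0 -> M *m v = 0) ->
  exists2 u : 'cV[R]_q, vec_gt u 0 & c = M^T *m u.
Proof.
move=> /farkas[w w0 cw] Mc.
have [v|l] := @farkas (q + 1) n (col_mx M (- c^T)) (- (M^T *m const_mx 1)).
  rewrite mul_col_mx mulNmx => /vec_ge_col_mx[Mv /(_ ord0) cv].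
  rewrite dotNl dot_trmul Mc ?dot0r ?oppr0 //.
  by move: cv; rewrite mxE [X in _ <= X]mxE oppr_ge0.
rewrite -(vsubmxK l) => /vec_ge_col_mx[l0 /(_ ord0)].
pose t : R := dsubmx l ord0 ord0; rewrite mxE -/t => t0.
rewrite tr_col_mx mul_row_col linearN /= trmxK mulNmx.
rewrite [dsubmx l]mx11_scalar -/t mul_mx_scalar => lE.
exists ((1 + t)^-1 *: (const_mx 1 + usubmx l + w)).
  move=> i; have := w0 i; have := l0 i; rewrite !mxE {cw lE} => ? ?.
  by rewrite mulr_gt0 ?invr_gt0; lra.
rewrite -scalemxAr !mulmxDr -cw.
have -> : M^T *m usubmx l = t *: c - M^T *m const_mx 1.
  by rewrite lE addrC subrK.
rewrite [_ + (_ - _)]addrC subrK.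
have -> : t *: c + c = (1 + t) *: c by rewrite scalerDl scale1r addrC.
by rewrite scalerA mulVf ?scale1r // gt_eqF // ltr_pwDl.
Qed.
End Farkas.

(** * Duality for the slope [dot b v + norm1 (E *m v)] on polyhedral cones *)

Section Duality.
Context {R : realType} (n q : nat).
Implicit Types (E : 'M[R]_(q, n)) (b v : 'cV[R]_n) (w s t : 'cV[R]_q).

(* [box_mx E] encodes [|E v| <= w] as linear inequalities in [(v, w)]. *)
Definition box_mx E : 'M[R]_(q + q, n + q) :=
  col_mx (row_mx (- E) 1%:M) (row_mx E 1%:M).

Lemma box_mxE E v w :
  box_mx E *m col_mx v w = col_mx (w - E *m v) (w + E *m v).
Proof.
by rewrite mul_col_mx !mul_row_col mulNmx !mul1mx addrC [E *m v + w]addrC.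
Qed.

Lemma tr_box_mxE E s t :
  (box_mx E)^T *m col_mx s t = col_mx (E^T *m (t - s)) (s + t).
Proof.
rewrite /box_mx tr_col_mx !tr_row_mx linearN /= !trmx1 mul_row_col !mul_col_mx.
by rewrite add_col_mx !mul1mx mulNmx addrC mulmxBr.
Qed.

Lemma norm1_le_box E v w : vec_ge (box_mx E *m col_mx v w) 0 ->
  vec_ge w 0 /\ norm1 (E *m v) <= dot (const_mx 1) w.
Proof.
rewrite box_mxE => /vec_ge_col_mx[wB wD].
have wE i : `|(E *m v) i ord0| <= w i ord0.
  by have := wB i; have := wD i; rewrite !mxE ler_norml; lra.
have w0 : vec_ge w 0 by move=> i; rewrite mxE (le_trans _ (wE i)).
split=> //; rewrite dot1_norm1 // ler_sum // => i _.
by rewrite (le_trans (wE i)) // ler_norm.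
Qed.

(** [strict_farkas] is applied in [(v, w)] to the linear cost [dot b v + dot 1 w]. The positive
    multipliers [s], [t] of the two halves of the box satisfy [s + t = 1], because [w] has cost 1,
    so [s - t] has entries strictly between -1 and 1. *)
Lemma strict_abs_farkas r (P : 'M[R]_(r, n)) E b :
  (forall v, v != 0 -> vec_ge (P *m v) 0 -> 0 < dot b v + norm1 (E *m v)) ->
  exists u s, [/\ vec_gt u 0, `|s| < 1 & b = P^T *m u - E^T *m s].
Proof.
move=> Pb.
pose M : 'M[R]_(r + (q + q), n + q) := col_mx (row_mx P 0) (box_mx E).
have ME v w : M *m col_mx v w = col_mx (P *m v) (box_mx E *m col_mx v w).
  by rewrite /M mul_col_mx mul_row_col mul0mx addr0.
have Mc x : vec_ge (M *m x) 0 ->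
    0 < dot (col_mx b (const_mx 1)) x \/ x = 0.
  rewrite -(vsubmxK x); move: (usubmx x) (dsubmx x) => v w.
  rewrite ME => /vec_ge_col_mx[Pv /norm1_le_box[w0 Ew]].
  (* For [v = 0] the cost is the sum of the entries of [w >= 0], so it is positive unless [w = 0] as
     well. *)
  rewrite dot_col_mx; have [->|v0] := eqVneq v 0.
    rewrite dot0r add0r; case: ltP => [_|c1]; [by left|right].
    rewrite (@dot_gt_eq0 _ _ (const_mx 1) w) ?col_mx0 //.
    by move=> i; rewrite !mxE ltr01.
  by left; rewrite (lt_le_trans (Pb _ v0 Pv)) // lerD2l.
have [x /Mc[/ltW//|->]|x Mx|u] :=
  @strict_farkas _ _ _ M (col_mx b (const_mx 1)).
- by rewrite dot0r.
- by have [|->] := Mc _ Mx; [rewrite ltNge => /negPf-> | rewrite mulmx0].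
rewrite -(vsubmxK u) -(vsubmxK (dsubmx u)).
move: (usubmx u) (usubmx (dsubmx u)) (dsubmx (dsubmx u)) => u1 s t.
move=> /vec_gt_col_mx[u0 /vec_gt_col_mx[s0 t0]].
rewrite /M tr_col_mx mul_row_col tr_box_mxE tr_row_mx trmx0 mul_col_mx mul0mx.
rewrite add_col_mx add0r => /eq_col_mx[bE st].
exists u1, (s - t); split=> //; last by rewrite bE -mulmxN opprB.
apply/mx_norm_ltP => // i; move/matrixP/(_ i ord0): st {bE}.
have := s0 i; have := t0 i.
by rewrite !mxE ltr_norml => ? ? ?; apply/andP; split; lra.
Qed.

Lemma strict_dualP m p (A : 'M[R]_(m, n)) (C : 'M[R]_(p, n)) E b :
  (forall v, v != 0 -> A *m v = 0 -> vec_ge (C *m v) 0 ->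
     0 < dot b v + norm1 (E *m v)) <->
  full_column_rank (col_mx A (col_mx C E)) /\
  exists u u' u'', vec_gt u' 0 /\ `|u''| < 1 /\
    A^T *m u + C^T *m u' - E^T *m u'' = b.
Proof.
split=> [Pb|[/full_column_rankP Ak [u [u' [u'' [u'0 [u''1 <-]]]]]] v v0 Av Cv].
  split.
    apply/full_column_rankP => v; rewrite !mul_col_mx -!col_mx0.
    move=> /eq_col_mx[Av /eq_col_mx[Cv Ev]].
    apply/eqP/negPn/negP => v0.
    (* A nonzero [v] in the common kernel satisfies the constraints together with [- v], so both
       [dot b v] and its opposite would be positive. *)
    have nz (k : nat) : vec_ge (0 : 'cV[R]_k) 0 by move=> i.
    have := Pb v v0 Av; rewrite Cv Ev norm10 => /(_ (nz _)).
    have := Pb (- v); rewrite oppr_eq0 !mulmxN Av Cv Ev !oppr0 norm10 dotNr.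
    by move=> /(_ v0 erefl (nz _)); clear; lra.
  (* The equation [A v = 0] is split into two inequalities; the difference of their multipliers is
     the multiplier of free sign. *)
  have [v v0|u [s [u0 s1 bE]]] :=
      @strict_abs_farkas _ (col_mx A (col_mx (- A) C)) E b.
    rewrite !mul_col_mx => /vec_ge_col_mx[Av /vec_ge_col_mx[ANv Cv]].
    apply: Pb => //; apply/matrixP => i j; rewrite (ord1 j).
    by have := Av i; have := ANv i; rewrite mulNmx !mxE; clear; lra.
  move: u0 bE; rewrite -(vsubmxK u) -(vsubmxK (dsubmx u)).
  move: (usubmx u) (usubmx (dsubmx u)) (dsubmx (dsubmx u)) => u1 u2 u3.
  move=> /vec_gt_col_mx[_ /vec_gt_col_mx[_ u30]].
  rewrite !tr_col_mx !mul_row_col linearN /= mulNmx => ->.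
  exists (u1 - u2), u3, s; do 2!split=> //.
  by rewrite mulmxBr addrA.
(* The slope is now [u'.Cv + (|Ev|_1 - u''.Ev)], with both parts nonnegative; if it were not
   positive, [Cv] and [Ev] would vanish, against full rank. *)
rewrite !(dotDl, dotNl) !dot_trmul Av dot0r add0r.
have c0 := dot_ge0 (fun i => ltW (u'0 i)) Cv.
have e0 : dot u'' (E *m v) <= norm1 (E *m v) by rewrite dot_le_norm1 // ltW.
rewrite ltNge; apply/negP => le0.
have Cv0 : C *m v = 0.
  by apply: (dot_gt_eq0 u'0 Cv); move: c0 e0 le0; clear; lra.
have Ev0 : E *m v = 0.
  by apply: (dot_ge_norm1_eq0 u''1); move: c0 e0 le0; clear; lra.
by move/eqP: v0; apply; apply: Ak; rewrite !mul_col_mx Av Cv0 Ev0 !col_mx0.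
Qed.

(** Read contrapositively, the left side says that [C v >= 0] and slope at most 0 force
    [dot g v >= 0], a Farkas statement for [g]. The multiplier [nu] of the slope constraint gives
    [theta] as its inverse. *)
Lemma weak_dualP p (g : 'cV[R]_n) (C : 'M[R]_(p, n)) E b :
  (forall v, dot g v < 0 -> vec_ge (C *m v) 0 ->
     0 < dot b v + norm1 (E *m v)) <->
  ((exists2 v, dot g v < 0 & vec_ge (C *m v) 0) ->
   exists theta ut ut', 0 < theta /\ vec_ge ut 0 /\ `|ut'| <= 1 /\
    theta *: g - C^T *m ut + b + E^T *m ut' = 0).
Proof.
split=> [Pb [v gv Cv]|dual v gv Cv]; last first.
  have [|th [ut [ut' [th0 [ut0 [ut1 e0]]]]]] := dual; first by exists v.
  have : dot (th *: g - C^T *m ut + b + E^T *m ut') v = 0.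
    by rewrite e0 dotC dot0r.
  rewrite !(dotDl, dotNl, dotZl) !dot_trmul.
  have := dot_ge0 ut0 Cv; have := dot_le_norm1 (E *m v) ut1.
  have : th * dot g v < 0 by rewrite pmulr_rlt0.
  by clear; lra.
pose c : 'cV_(n + q) := col_mx b (const_mx 1).
pose M := col_mx (row_mx C 0) (col_mx (- c^T) (box_mx E)).
have [x|u] := @farkas _ _ _ M (col_mx g 0).
  rewrite -(vsubmxK x); move: (usubmx x) (dsubmx x) => v' w.
  rewrite 2!mul_col_mx mul_row_col mul0mx addr0.
  move=> /vec_ge_col_mx[Cv' /vec_ge_col_mx[/(_ ord0)]].
  rewrite mulNmx mxE [X in _ <= X]mxE -/(dot c _) dot_col_mx => cv'.
  move=> /norm1_le_box[_ Ew].
  rewrite dot_col_mx [dot 0 w]dotC dot0r addr0 leNgt; apply/negP => /Pb/(_ Cv').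
  by lra.
rewrite -(vsubmxK u) -(vsubmxK (dsubmx u)) -(vsubmxK (dsubmx (dsubmx u))).
move: (usubmx u) (usubmx (dsubmx u)) => u1 nu'.
move: (usubmx (dsubmx (dsubmx u))) (dsubmx (dsubmx (dsubmx u))) => s t.
move=> /vec_ge_col_mx[u10 /vec_ge_col_mx[nu0 /vec_ge_col_mx[s0 t0]]].
rewrite /M 2!tr_col_mx 2!mul_row_col tr_box_mxE tr_row_mx trmx0 mul_col_mx.
rewrite mul0mx linearN /= trmxK [nu']mx11_scalar mul_mx_scalar.
move: (nu' _ _) (nu0 ord0) => nu; rewrite mxE => {}nu0.
rewrite scalerN scale_col_mx opp_col_mx !add_col_mx add0r.
move=> /eq_col_mx[gE]; rewrite addrC => /esym/eqP; rewrite subr_eq0 => /eqP st.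
have stE i : s i ord0 + t i ord0 = nu.
  by have /matrixP/(_ i ord0) := st; rewrite !mxE mulr1.
(* If [nu = 0] then [s = t = 0] and [g = C^T u1], so [dot g v >= 0] for the given [v], a
   contradiction. This is where nonemptiness of the cone enters. *)
have nu_gt0 : 0 < nu.
  rewrite lt_neqAle nu0 andbT; apply: contraTneq gv => nu_eq0.
  have ts0 : t - s = 0.
    apply/matrixP => i j; rewrite (ord1 j) !mxE; move: (stE i) (s0 i) (t0 i).
    by rewrite !mxE -nu_eq0; clear; lra.
  rewrite -leNgt gE ts0 -nu_eq0 scale0r !mulmx0 oppr0 !addr0.
  by rewrite dot_trmul dot_ge0.
(* Dividing by [nu] makes the coefficient of [b] equal to 1; [s + t = nu] bounds the entries of
   [s - t] by [nu]. *)
exists nu^-1, (nu^-1 *: u1), (nu^-1 *: (s - t)).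
split; first by rewrite invr_gt0.
split.
  by move=> i; have := u10 i; rewrite !mxE => ?; rewrite mulr_ge0 ?invr_ge0.
split.
  apply/mx_norm_leP => // i; rewrite mxE normrM gtr0_norm ?invr_gt0 //.
  rewrite mulrC ler_pdivrMr // mul1r.
  move: (stE i) (s0 i) (t0 i); rewrite !mxE ler_norml; clear.
  by move=> *; apply/andP; split; lra.
rewrite -!scalemxAr -scalerBr gE [X in X - _]addrC addrK scalerDr scalerN.
rewrite scalerA mulVf ?gt_eqF // scale1r [- b + _ + b]addrAC addNr add0r.
rewrite -scalerDr -mulmxDr.
by rewrite -opprB addNr mulmx0 scaler0.
Qed.
End Duality.

(** * Descent directions of differentiable and strictly convex functions *)

Section Descent.
Context {R : realType} (m : nat).
Implicit Types (f : 'cV[R]_m -> R) (z w : 'cV[R]_m).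

Lemma near0_mul_lt (a c : R) : 0 < a -> \forall t \near 0^'+, t * c < a.
Proof.
move=> a0; near=> t.
have t0 : 0 < t by near: t; exact: nbhs_right_gt.
(* [c] may have any sign; the positive bound [|c| + 1] gives the threshold [a / (|c| + 1)] for
   [t]. *)
apply: (@le_lt_trans _ _ (t * (`|c| + 1))).
  by rewrite ler_pM2l // (le_trans (ler_norm c)) // lerDl.
rewrite -ltr_pdivlMr ?ltr_wpDl //.
by near: t; apply: nbhs_right_lt; rewrite divr_gt0 // ltr_wpDl.
Unshelve. all: by end_near. Qed.

Lemma derive_grad f z w : differentiable f z -> 'D_w f z = dot (grad f z) w.
Proof.
move=> df; rewrite deriveE // {1}[w]matrix_sum_delta linear_sum dotE.
apply: eq_bigr => i _; rewrite big_ord1 linearZ /= mxE -deriveE //.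
by rewrite mulrC.
Qed.

Lemma cvg_grad f z w : differentiable f z ->
  t^-1 * (f (z + t *: w) - f z) @[t --> 0^'+] --> dot (grad f z) w.
Proof.
move=> df; rewrite -derive_grad //.
have -> : (fun t => t^-1 * (f (z + t *: w) - f z)) =
    (fun t => t^-1 *: ((f \o shift z) (t *: w) - f z)).
  by apply/funext => t /=; rewrite [z + _]addrC.
exact/cvg_dnbhs_at_right/diff_derivable.
Qed.

Lemma grad_lt0_descent f z w : differentiable f z -> dot (grad f z) w < 0 ->
  \forall t \near 0^'+, f (z + t *: w) < f z.
Proof.
move=> df gw; have q0 := cvgr_lt _ (@cvg_grad f z w df) _ gw; near=> t.
have t0 : 0 < t by near: t; exact: nbhs_right_gt.
rewrite -subr_lt0 -(@pmulr_rlt0 _ t^-1) ?invr_gt0 //.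
by near: t; exact: q0.
Unshelve. all: by end_near. Qed.

Lemma strictly_convex_segment f z w t : strictly_convex f -> 0 < t < 1 ->
  w != 0 -> f (z + t *: w) < f z + t * (f (z + w) - f z).
Proof.
move=> cf t01 w0; have := cf (z + w) z t _ t01.
rewrite scalerDr addrAC -scalerDl addrC addrC subrKC scale1r.
by rewrite -[X in _ != X]addr0 (inj_eq (addrI z)) => /(_ w0); lra.
Qed.

(** Strict convexity makes [f] strictly smaller at the midpoint [z + h] than at [z]. Difference
    quotients along [h] are at most [f (z + h) - f z < 0], a bound that survives the limit. *)
Lemma strictly_convex_descent f z w : strictly_convex f ->
  differentiable f z -> w != 0 -> f (z + w) <= f z -> dot (grad f z) w < 0.
Proof.
move=> cf df w0 fzw; pose h := 2^-1 *: w.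
have h0 : h != 0 by rewrite scaler_eq0 negb_or w0 andbT; lra.
have fzh : f (z + h) < f z.
  have half : 0 < (2^-1 : R) < 1 by lra.
  by have := @strictly_convex_segment f z w _ cf half w0; rewrite -/h; lra.
have wE : w = 2 *: h by rewrite scalerA divff ?scale1r.
rewrite wE dotZr pmulr_rlt0 //.
apply: (@le_lt_trans _ _ (f (z + h) - f z)); last by rewrite subr_lt0.
apply: (ler_cvg_to (@cvg_grad f z h df) (cvg_cst _)).
near=> t.
have t0 : 0 < t by near: t; exact: nbhs_right_gt.
have t1 : t < 1 by near: t; exact: nbhs_right_lt.
rewrite mulrC ler_pdivrMr // lerBlDl mulrC ltW //.
by apply: strictly_convex_segment; rewrite ?t0.
Unshelve. all: by end_near. Qed.

Lemma strictly_convex_near_lt f z w e : strictly_convex f -> f z < e ->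
  \forall t \near 0^'+, f (z + t *: w) < e.
Proof.
move=> cf fze; near=> t.
have t0 : 0 < t by near: t; exact: nbhs_right_gt.
have t1 : t < 1 by near: t; exact: nbhs_right_lt.
have [->|w0] := eqVneq w 0; first by rewrite scaler0 addr0.
apply: lt_trans (strictly_convex_segment _ cf _ w0) _; first by rewrite t0.
rewrite -ltrBrDl; near: t; apply: near0_mul_lt.
by rewrite subr_gt0.
Unshelve. all: by end_near. Qed.

End Descent.

(** * First-order behaviour of the objective *)

Section Norm1.
Context {R : realType} (N : nat).

(* The directional derivative at [x] of [x |-> norm1 (E *m x)]. *)
Definition dnorm1 k (E : 'M[R]_(k, N)) (x v : 'cV[R]_N) : R :=
  dot (b_vec E x) v + norm1 (subrows E (~: support_set E x)%SET *m v).

Lemma subrowsM q n (M : 'M[R]_(q, N)) (beta : {set 'I_q}) (B : 'M[R]_(N, n)) :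
  subrows M beta *m B = subrows (M *m B) beta.
Proof. by rewrite /subrows mul_rowsub_mx. Qed.

Lemma dnorm1E k (E : 'M[R]_(k, N)) x v : dnorm1 E x v =
  \sum_i (if (E *m x) i ord0 != 0
          then Num.sg ((E *m x) i ord0) * (E *m v) i ord0
          else `|(E *m v) i ord0|).
Proof.
rewrite (bigID (mem (support_set E x))) /=; congr (_ + _).
  rewrite /b_vec dot_trmul subrowsM dotE.
  under [RHS]eq_bigr => i; first by rewrite inE => ->; over.
  rewrite [RHS]big_enum_val; apply: eq_bigr => i _.
  by rewrite !mxE.
rewrite subrowsM /norm1.
under [RHS]eq_bigr => i; first by rewrite inE => /negPf->; over.
rewrite [RHS](eq_bigl (fun i => i \in (~: support_set E x)%SET)) => [|i].
  by rewrite [RHS]big_enum_val; apply: eq_bigr => i _; rewrite !mxE.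
by rewrite finset.in_setC.
Qed.

(** Convexity, entry by entry: for [a != 0], [|a| + sg a * c = sg a * (a + c) <= |a + c|]. *)
Lemma norm1_ge_dnorm1 k (E : 'M[R]_(k, N)) x v :
  norm1 (E *m x) + dnorm1 E x v <= norm1 (E *m (x + v)).
Proof.
rewrite dnorm1E /norm1 -big_split ler_sum // => i _ /=.
rewrite mulmxDr [(E *m x + E *m v) i _]mxE.
move: ((E *m x) i ord0) ((E *m v) i ord0) => a c.
have [->|a0] /= := eqVneq a 0; first by rewrite normr0 !add0r.
have -> : `|a| = Num.sg a * a by rewrite normrEsg.
by rewrite -mulrDr (le_trans (ler_norm _)) // normrM normr_sg a0 mul1r.
Qed.

(** A nonzero entry of [E *m x] keeps its sign while [t * |(E v) i| < |(E x) i|], and a zero entry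
    contributes [t * |(E v) i|] exactly. Finitely many rows allow a common range of [t]. *)
Lemma norm1_near_dnorm1 k (E : 'M[R]_(k, N)) x v : \forall t \near 0^'+,
  norm1 (E *m (x + t *: v)) = norm1 (E *m x) + t * dnorm1 E x v.
Proof.
have h i : \forall t \near (0 : R)^'+,
    t * `|(E *m v) i ord0| < `|(E *m x) i ord0| \/ (E *m x) i ord0 = 0.
  have [e|e] := eqVneq ((E *m x) i ord0) 0; first by near=> t; right.
  have /near0_mul_lt : 0 < `|(E *m x) i ord0| by rewrite normr_gt0.
  by move=> /(_ `|(E *m v) i ord0|); apply: filterS => t; left.
have {}h := @filter_forall _ _ _ ((0 : R)^'+) _ h.
near=> t.
have t0 : 0 < t by near: t; exact: nbhs_right_gt.
have ht : forall i, t * `|(E *m v) i ord0| < `|(E *m x) i ord0|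
    \/ (E *m x) i ord0 = 0 by near: t; exact: h.
rewrite dnorm1E /norm1 mulr_sumr -big_split; apply: eq_bigr => i _ /=.
rewrite mulmxDr -scalemxAr [(E *m x + t *: (E *m v)) i _]mxE.
rewrite [(t *: (E *m v)) i _]mxE.
move: (ht i); move: ((E *m x) i ord0) ((E *m v) i ord0) => a c.
have [->|a0] /= := eqVneq a 0.
  by rewrite normr0 !add0r normrM gtr0_norm.
case=> [tc|/eqP]; last by rewrite (negPf a0).
have : `|t * c| < `|a| by rewrite normrM gtr0_norm.
rewrite ltr_norml; case: (ltgtP a 0) a0 => // a0 _.
  rewrite (ltr0_norm a0) (ltr0_sg a0) => /andP[? ?].
  by rewrite ltr0_norm; lra.
rewrite (gtr0_norm a0) (gtr0_sg a0) => /andP[? ?].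
by rewrite gtr0_norm; lra.
Unshelve. all: by end_near. Qed.

End Norm1.

(** * Feasible directions and unique minimizers *)

Section FeasibleDirections.
Context {R : realType} (N : nat).
Implicit Types (x xs v : 'cV[R]_N).

(** [D] stands for the cone of feasible directions, to be chosen in each case. A nonzero [v] in [D]
    of nonpositive slope yields a second minimizer by a small step; conversely, positive slopes
    suffice because [norm1_ge_dnorm1] holds for steps of any length. *)
Lemma unique_minimizer_dnorm1P k (E : 'M[R]_(k, N)) (feas D : set 'cV[R]_N) xs :
  feas xs -> (forall x, feas x -> D (x - xs)) ->
  (forall v, D v -> \forall t \near 0^'+, feas (xs + t *: v)) ->
  is_unique_minimizer (fun x => norm1 (E *m x)) feas xs <->
  forall v, v != 0 -> D v -> 0 < dnorm1 E xs v.
Proof.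
move=> fxs fD Df; split=> [[[_ mxs] uxs] v v0 Dv|D0].
  rewrite ltNge; apply/negP => dv.
  have /filter_ex[t [[t0 ft] et]] : \forall t \near 0^'+,
      (0 < t /\ feas (xs + t *: v)) /\
      norm1 (E *m (xs + t *: v)) = norm1 (E *m xs) + t * dnorm1 E xs v.
    near=> t; split; last by near: t; exact: norm1_near_dnorm1.
    by split; near: t; [exact: nbhs_right_gt|exact: Df].
  have mxt : norm1 (E *m (xs + t *: v)) <= norm1 (E *m xs).
    by rewrite et gerDl pmulr_rle0.
  have /uxs : is_minimizer (fun x => norm1 (E *m x)) feas (xs + t *: v).
    by split=> // z fz; rewrite (le_trans mxt) ?mxs.
  move=> /eqP; rewrite -subr_eq0 addrC addKr scaler_eq0 (negPf v0) orbF.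
  by rewrite gt_eqF.
have uxs x : feas x -> norm1 (E *m x) <= norm1 (E *m xs) -> x = xs.
  move=> fx mx; apply/eqP; rewrite -subr_eq0; apply/negPn/negP => x0.
  have := D0 _ x0 (fD _ fx); have := norm1_ge_dnorm1 E xs (x - xs).
  by rewrite subrKC; lra.
split=> [|x [fx mx]]; last by apply: uxs => //; exact: mx.
split=> // x fx; rewrite leNgt; apply/negP => lt; move: (lt).
by rewrite (uxs _ fx (ltW lt)) ltxx.
Unshelve. all: by end_near. Qed.

Lemma active_direction p (C : 'M[R]_(p, N)) d xs x :
  vec_ge (C *m x) d -> vec_ge (subrows C (active_set C d xs) *m (x - xs)) 0.
Proof.
move=> Cx i; rewrite subrowsM [X in X <= _]mxE [X in _ <= X]mxE.
move: (enum_val i) (enum_valP i) => j; rewrite inE mulmxBr => /eqP act.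
by have := Cx j; move: act; rewrite !mxE; lra.
Qed.

(** Active rows do not decrease along [v], and inactive rows have positive slack, which a small step
    cannot exhaust. *)
Lemma active_direction_near p (C : 'M[R]_(p, N)) d xs v :
  vec_ge (C *m xs) d -> vec_ge (subrows C (active_set C d xs) *m v) 0 ->
  \forall t \near 0^'+, vec_ge (C *m (xs + t *: v)) d.
Proof.
move=> Cxs Cv; apply: filter_forall => j.
have [act|inact] := boolP (j \in active_set C d xs).
  near=> t.
  have t0 : 0 < t by near: t; exact: nbhs_right_gt.
  rewrite mulmxDr -scalemxAr [(C *m xs + t *: (C *m v)) j _]mxE.
  rewrite [(t *: (C *m v)) j _]mxE (le_trans (Cxs j)) // lerDl.
  rewrite mulr_ge0 ?(ltW t0) //.
  have := Cv (enum_rank_in act j); rewrite subrowsM [X in X <= _]mxE.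
  by rewrite [X in _ <= X]mxE enum_rankK_in.
have Cj : 0 < (C *m xs) j ord0 - d j ord0.
  move: inact; rewrite inE mxE [(- d) j _]mxE lt_neqAle eq_sym => ->.
  by rewrite subr_ge0; exact: Cxs.
apply: filterS (near0_mul_lt (- (C *m v) j ord0) Cj) => t.
rewrite mulmxDr -scalemxAr [(C *m xs + t *: (C *m v)) j _]mxE.
by rewrite [(t *: (C *m v)) j _]mxE; lra.
Unshelve. all: by end_near. Qed.

End FeasibleDirections.

(** * Characterisation of the unique minimizer in the slack and the active case *)

Theorem proposition4p3 (R : realType) (k N m p : nat)
    (E : 'M[R]_(k, N)) (A : 'M[R]_(m, N)) (y : 'cV[R]_m)
    (C : 'M[R]_(p, N)) (d : 'cV[R]_p) (eps : R) (f : 'cV[R]_m -> R)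
    (xs : 'cV[R]_N) :
  E != 0 -> C1_function f -> strictly_convex f ->
  let obj := fun x : 'cV[R]_N => norm1 (E *m x) in
  let feas := feasible_set f A y eps C d in
  (exists x, is_minimizer obj feas x) ->
  feas xs ->
  let Ca := subrows C (active_set C d xs) in
  let Ec := subrows E (~: support_set E xs)%SET in
  let b := b_vec E xs in
  let g := grad f (A *m xs - y) in
  let K := [set v : 'cV[R]_N |
             (g^T *m (A *m v)) ord0 ord0 < 0 /\ vec_ge (Ca *m v) 0] in
  (f (A *m xs - y) < eps ->
    (is_unique_minimizer obj feas xs <->
      full_column_rank (col_mx Ca Ec) /\
      exists (u : 'cV[R]_#|active_set C d xs|)
             (u' : 'cV[R]_#|(~: support_set E xs)%SET|),
        vec_gt u 0 /\ `|u'| < 1 /\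
        Ca^T *m u = b + Ec^T *m u'))
  /\
  (f (A *m xs - y) = eps ->
    (is_unique_minimizer obj feas xs <->
      full_column_rank (col_mx A (col_mx Ca Ec)) /\
      (exists (u : 'cV[R]_m) (u' : 'cV[R]_#|active_set C d xs|)
              (u'' : 'cV[R]_#|(~: support_set E xs)%SET|),
        vec_gt u' 0 /\ `|u''| < 1 /\
        A^T *m u + Ca^T *m u' - Ec^T *m u'' = b) /\
      (K !=set0 ->
        exists (theta : R) (ut : 'cV[R]_#|active_set C d xs|)
               (ut' : 'cV[R]_#|(~: support_set E xs)%SET|),
          0 < theta /\ vec_ge ut 0 /\ `|ut'| <= 1 /\
          theta *: (A^T *m g) - Ca^T *m ut + b + Ec^T *m ut' = 0))).
Proof.
move=> _ [df _] cf obj feas _ fxs Ca Ec b g K.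
have [_ Cxs] := fxs.
have fE t v : f (A *m (xs + t *: v) - y) = f (A *m xs - y + t *: (A *m v)).
  by rewrite mulmxDr -scalemxAr addrAC.
split=> [f_lt|f_eq].
  rewrite (@unique_minimizer_dnorm1P _ _ _ E feas
    (fun v => vec_ge (Ca *m v) 0)) //.
  (* A matrix with no rows stands in for [A]: its equation is vacuous and its multiplier term
     vanishes. *)
  - have := strict_dualP (0 : 'M[R]_(0, N)) Ca Ec b => dual.
    split=> [D0|[rk [u [u' [u0 [u'1 uE]]]]]].
      have [|rk [w [u [u' [u0 [u'1 uE]]]]]] := dual.1 _.
        by move=> v v0 _ Cv; exact: D0.
      split.
        apply/full_column_rankP => v Mv.
        move/full_column_rank_col_mx: rk; apply=> //.
        by apply/matrixP => -[].
      exists u, u'; do 2!split=> //.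
      by rewrite -uE trmx0 mul0mx add0r subrK.
    move=> v v0 Cv; apply: dual.2 => //; last by apply/matrixP => -[].
    split.
      apply/full_column_rank_col_mx => w _.
      by move/full_column_rankP: rk; apply.
    exists 0, u, u'; do 2!split=> //.
    by rewrite uE mulmx0 add0r addrK.
  - by move=> x [_ Cx]; exact: active_direction.
  - move=> v Cv.
    apply: filterS2 (strictly_convex_near_lt (A *m v) cf f_lt)
                    (active_direction_near Cxs Cv) => t ft Ct.
    by split=> //; rewrite fE ltW.
rewrite (@unique_minimizer_dnorm1P _ _ _ E feas
  (fun v => vec_ge (Ca *m v) 0 /\ (A *m v = 0 \/ dot g (A *m v) < 0))) //.
- have wdual := weak_dualP (A^T *m g) Ca Ec b.
  have KE : K !=set0 <->
      exists2 v, dot (A^T *m g) v < 0 & vec_ge (Ca *m v) 0.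
    split=> -[v]; first by case=> gv Cv; exists v; rewrite ?dot_trmul.
    by rewrite dot_trmul; exists v.
  have sdual := strict_dualP A Ca Ec b.
  (* Directions with [A v = 0] are handled by [sdual], giving (a) and (b); those with
     [dot g (A *m v) < 0] by [wdual], giving (c). *)
  split=> [D0|[rk [ex cond]] v v0 [Cv Av]].
    have [|rk ex] := sdual.1 _.
      by move=> v v0 Av Cv; apply: D0 => //; split=> //; left.
    do 2!split=> //.
    rewrite KE; apply/wdual => v; rewrite dot_trmul => gv Cv.
    apply: D0; last by split=> //; right.
    by apply: contraTneq gv => ->; rewrite mulmx0 dot0r ltxx.
  case: Av => [Av|gv]; first by apply: sdual.2.
  by apply: wdual.2; rewrite -?KE ?dot_trmul.
- move=> x [fx Cx]; split; first exact: active_direction.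
  have [|Av] := eqVneq (A *m (x - xs)) 0; [by left|right].
  apply: strictly_convex_descent => //.
  (* The step [A (x - xs)] leads from [A xs - y] to [A x - y], where [f] is at most [eps], its value
     at the start. *)
  by rewrite f_eq mulmxBr [A *m xs - y + _]addrC addrA subrK.
- move=> v [Cv Av].
  (* If [A v = 0], [f] stays equal to [eps] along the ray; otherwise the negative slope makes it
     decrease at first. *)
  have fv : \forall t \near 0^'+, f (A *m xs - y + t *: (A *m v)) <= eps.
    case: Av => [->|gv].
      by near=> t; rewrite scaler0 addr0 f_eq.
    by apply: filterS (grad_lt0_descent (df _) gv) => t /ltW; rewrite f_eq.
  apply: filterS2 fv (active_direction_near Cxs Cv) => t ft Ct.
  by split=> //; rewrite fE.
Unshelve. all: by end_near. Qed.
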